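(* If $\boldsymbol U\in G_c$, then for each of $\boldsymbol n=(1,1)^\top$ and $\boldsymbol n=(1,-1)^\top$, $$\boldsymbol F(\boldsymbol U)\cdot\boldsymbol n> s_1(\boldsymbol U)\,\boldsymbol U\cdot\boldsymbol n,\qquad \boldsymbol F(\boldsymbol U)\cdot\boldsymbol n< s_2(\boldsymbol U)\,\boldsymbol U\cdot\boldsymbol n,$$ where $$s_1(\boldsymbol U):=\frac{v-\sqrt{P'(\rho)}}{1-\sqrt{P'(\rho)}\,v}<0,\qquad s_2(\boldsymbol U):=\frac{v+\sqrt{P'(\rho)}}{1+\sqrt{P'(\rho)}\,v}>0$$ are the eigenvalues of the Jacobian $\partial\boldsymbol F/\partial\boldsymbol U$, and $\boldsymbol V(\boldsymbol U)=(\rho,p,v)$ is the primitive state corresponding to $\boldsymbol U$.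
   Context: Equation of state: $p=P(\rho)$, where $P(0)=0$, $0<P'(\rho)<1$, and $P(\rho)<\sqrt{P'(\rho)}\,\rho$ for $\rho>0$. (The speed of light is $1$.) Primitive variables $\boldsymbol V=(\rho,p,v)^\top$; $G_p=\{(\rho,p,v)^\top:\rho>0,\ p>0,\ |v|<1\}$. With $W=1/\sqrt{1-v^2}$ set $\mathcal T^{00}=(\rho+p)W^2-p$, $\mathcal T^{01}=(\rho+p)W^2v$, $\mathcal T^{11}=(\rho v^2+p)W^2$. Conservative vector $\boldsymbol U=(\mathcal T^{00},\mathcal T^{01})^\top$, flux $\boldsymbol F(\boldsymbol U)=(\mathcal T^{01},\mathcal T^{11})^\top$. The admissible set is $G_c=\{\boldsymbol U=(\mathcal T^{00},\mathcal T^{01})^\top:\boldsymbol U\cdot\boldsymbol n>0 \text{ for } \boldsymbol n=(1,1)^\top \text{ and } \boldsymbol n=(1,-1)^\top\}$; each $\boldsymbol U\in G_c$ is the conservative vector of a primitive state $\boldsymbol V(\boldsymbol U)=(\rho,p,v)^\top\in G_p$ with $p=P(\rho)$.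
   Formalization: The signs s_1<0 and s_2>0 fail for supersonic states (P=ρ/4, ρ=1, v=9/10 gives s_1=8/11>0); they are replaced by: s_1<0 iff v<√P'(ρ), and s_2>0 iff v>-√P'(ρ). Continuity of P on [0,∞) is stated explicitly. *)

(* Defs.v *)
From HB Require Import structures.
From mathcomp Require Import all_boot all_order all_algebra.
From mathcomp Require Import all_classical all_reals all_analysis.

Set Implicit Arguments.
Unset Strict Implicit.
Unset Printing Implicit Defensive.

Import Order.TTheory GRing.Theory Num.Theory.
Import numFieldNormedType.Exports.

Local Open Scope classical_set_scope.
Local Open Scope ring_scope.

Definition vec2 (R : realType) (a b : R) : 'rV[R]_2 :=
  \row_(i < 2) (if i == 0 then a else b).

Definition dot (R : realType) (x y : 'rV[R]_2) : R :=
  \sum_(i < 2) x 0 i * y 0 i.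

(* Continuity on [0, +oo) is the usual regularity of an equation of state.  It
   has content only at 0: without it P(rho) = rho / 2 - 1 for rho > 0 would
   qualify, and low-energy states would have no positive pressure. *)
Definition equation_of_state (R : realType) (P : R -> R) : Prop :=
  [/\ P 0 = 0,
      {within `[0, +oo[, continuous P} &
      forall rho : R, 0 < rho ->
        [/\ derivable P rho 1,
            0 < derive1 P rho < 1 &
            P rho < Num.sqrt (derive1 P rho) * rho]].

(* A triple ((rho, p), v) of type R * R * R is the primitive state
   (rho, p, v). *)
Definition Gp (R : realType) : set (R * R * R) :=
  [set V | let: (rho, p, v) := V in [/\ 0 < rho, 0 < p & `|v| < 1]].

Definition lorentz (R : realType) (v : R) : R := 1 / Num.sqrt (1 - v ^+ 2).

Definition T00 (R : realType) (V : R * R * R) : R :=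
  let: (rho, p, v) := V in (rho + p) * lorentz v ^+ 2 - p.

Definition T01 (R : realType) (V : R * R * R) : R :=
  let: (rho, p, v) := V in (rho + p) * lorentz v ^+ 2 * v.

Definition T11 (R : realType) (V : R * R * R) : R :=
  let: (rho, p, v) := V in (rho * v ^+ 2 + p) * lorentz v ^+ 2.

Definition conservative (R : realType) (V : R * R * R) : 'rV[R]_2 :=
  vec2 (T00 V) (T01 V).

Definition Gc (R : realType) : set 'rV[R]_2 :=
  [set U | 0 < dot U (vec2 1 1) /\ 0 < dot U (vec2 1 (-1))].

Definition primitive_states (R : realType) (P : R -> R) (U : 'rV[R]_2) :
    set (R * R * R) :=
  [set V | [/\ Gp V, V.1.2 = P V.1.1 & conservative V = U]].

(* The value is (0, 0, 0) when U has no primitive state. *)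
Definition primitive (R : realType) (P : R -> R) (U : 'rV[R]_2) : R * R * R :=
  xget (0, 0, 0) (primitive_states P U).

Definition flux (R : realType) (P : R -> R) (U : 'rV[R]_2) : 'rV[R]_2 :=
  vec2 (T01 (primitive P U)) (T11 (primitive P U)).

Definition sound_speed (R : realType) (P : R -> R) (U : 'rV[R]_2) : R :=
  Num.sqrt (derive1 P (primitive P U).1.1).

Definition velocity (R : realType) (P : R -> R) (U : 'rV[R]_2) : R :=
  (primitive P U).2.

Definition s1 (R : realType) (P : R -> R) (U : 'rV[R]_2) : R :=
  (velocity P U - sound_speed P U) / (1 - sound_speed P U * velocity P U).

Definition s2 (R : realType) (P : R -> R) (U : 'rV[R]_2) : R :=
  (velocity P U + sound_speed P U) / (1 + sound_speed P U * velocity P U).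

(* Main.v *)
Require Import Defs.
From HB Require Import structures.
From mathcomp Require Import all_boot all_order all_algebra.
From mathcomp Require Import all_classical all_reals all_analysis.
From mathcomp Require Import ring lra.

Set Implicit Arguments.
Unset Strict Implicit.
Unset Printing Implicit Defensive.

Import Order.TTheory GRing.Theory Num.Theory.
Import numFieldNormedType.Exports.

Local Open Scope classical_set_scope.
Local Open Scope ring_scope.

(** Write E, m for the coordinates of U, so that E > |m| on the admissible set.
A primitive state satisfies m = (E + p) v and E - rho = (E + p) v ^ 2; hence
rho solves the scalar equation (E - rho) (E + P rho) = m ^ 2 and everything
else is a function of rho.  By the mean value theorem 0 < P' < 1 makes the
left-hand side strictly decreasing in rho >= 0, with value E ^ 2 > m ^ 2 at 0
and 0 <= m ^ 2 at E, so there is exactly one root, and it is positive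
([momentum_sqr_decr], [momentum_sqr_root], [primitive_unique]).

With w = E + p and c the sound speed, multiplying F.n - s1 U.n and
s2 U.n - F.n by their positive denominators leaves a product of 1 + v or
1 - v with c rho + p or c rho - p, all of which are positive because
|v| < 1 and p < c rho ([flux_between_characteristics]).

For the eigenvalues, the flux on the admissible set is (m, E - rho + p), so
its Jacobian is a companion matrix and its eigenvalues are the roots of a
quadratic; the point is to differentiate rho as a function of U.  Instead of a
general implicit function theorem, Caratheodory's form of the derivative is
used: monotonicity squeezes rho(U') between neighbours of rho(U), whence rho is
continuous ([cvg_density]); then subtracting the defining equation at two
points expresses the increment of rho exactly, with coefficients that are
continuous functions of the moving point and whose values at U are the partial
derivatives of rho.  The resulting partial derivatives of E - rho + p in E and
m are - s1 s2 and s1 + s2 ([flux_jacobian]), so that the quadratic is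
(X - s1) (X - s2) ([eigenvalue_companion2]). *)

(** * Derivatives of maps between row vectors *)

Lemma norm_entry_le (R : realType) n m (M : 'M[R]_(n, m)) i j :
  `|M i j| <= `|M|.
Proof.
rewrite [leRHS]/Num.norm /= mx_normrE.
exact: (le_bigmax _ (fun ij => `|M ij.1 ij.2|) (i, j)).
Qed.

Lemma mx_norm_mulmx_le (R : realType) n m (v : 'rV[R]_n) (B : 'M[R]_(n, m))
    (e : R) : 0 <= e -> (forall i j, `|B i j| <= e) ->
  `|v *m B| <= n%:R * e * `|v|.
Proof.
move=> e0 Be.
rewrite [leLHS]/Num.norm /= mx_normrE; apply/bigmax_leP; split => [|[i j] _ /=].
  by rewrite !mulr_ge0.
rewrite mxE (le_trans (ler_norm_sum _ _ _))//.
have -> : n%:R * e * `|v| = \sum_(k < n) `|v| * e.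
  by rewrite sumr_const card_ord -[RHS]mulr_natl; ring.
by apply: ler_sum => k _; rewrite normrM ler_pM// norm_entry_le.
Qed.

Lemma mulmxr_continuous (R : realType) n m (B : 'M[R]_(n, m)) :
  continuous (fun v : 'rV[R]_n => v *m B).
Proof.
move=> x; apply/(@cvgrPdist_le _ _ _ (nbhs x) (nbhs_filter x)) => e e0.
pose b := n%:R * `|B| + 1.
have b0 : 0 < b by rewrite ltr_wpDl// mulr_ge0.
near=> y; rewrite -mulmxBl.
apply: (@le_trans _ _ (b * `|x - y|)).
  apply: (le_trans (@mx_norm_mulmx_le _ _ _ _ _ `|B| _ _)) => //.
    exact: norm_entry_le.
  by rewrite ler_wpM2r// lerDl.
rewrite -ler_pdivlMl//; near: y.
by apply: cvgr_dist_le => //; rewrite mulr_gt0 ?invr_gt0.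
Unshelve. all: by end_near. Qed.

Lemma is_diff_near_norm (R : realType) (V W : normedModType R) (f : V -> W)
    (L : {linear V -> W}) (x : V) : continuous L ->
  (forall e, 0 < e ->
    \forall y \near x, `|f y - f x - L (y - x)| <= e * `|y - x|) ->
  is_diff x f L.
Proof.
move=> Lc fxL.
have fL : f \o shift x = cst (f x) + L +o_ 0 id.
  apply/eqaddoP => e e0; have := fxL _ e0.
  rewrite (near_shift 0 x) -nbhs_nearE nbhs_simpl /=.
  by apply: filterS => y /=; rewrite subr0 addrK opprD addrA.
have df : 'd f x = L :> (_ -> _) by exact: diff_unique.
by apply: DiffDef => //; apply/diff_locallyP; rewrite df.
Qed.

(** Caratheodory's criterion: an exact factorization of the increment through a
matrix that depends continuously on the point leaves an error
(y - x) (A y - A x), which is o(y - x).  It avoids handling remainders when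
differentiating an implicitly defined function. *)
Lemma jacobian_caratheodory (R : realType) n m (f : 'rV[R]_n -> 'rV[R]_m)
    (x : 'rV[R]_n) (A : 'rV[R]_n -> 'M[R]_(n, m)) :
  (forall i j, {for x, continuous (fun y => A y i j)}) ->
  (\forall y \near x, f y - f x = (y - x) *m A y) ->
  differentiable f x /\ jacobian f x = A x.
Proof.
move=> Ac fA.
pose L : {linear 'rV[R]_n -> 'rV[R]_m} := mulmxr (A x).
have Lc : continuous L by exact: mulmxr_continuous.
suff fL : is_diff x f L.
  split; first exact: (@ex_diff _ _ _ _ _ _ _ fL).
  apply/matrixP => i j.
  by rewrite /jacobian mxE (@diff_val _ _ _ _ _ _ _ fL) /= -rowE mxE.
apply: is_diff_near_norm => // e e0.
pose d := e / (n%:R + 1).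
have n1 : 0 < n%:R + 1 :> R by rewrite ltr_wpDl.
have d0 : 0 < d by rewrite divr_gt0.
have Ad : \forall y \near x, forall i j, `|(A y - A x) i j| <= d.
  apply: (@filter_forall _ _ _ (nbhs x) _) => i.
  apply: (@filter_forall _ _ _ (nbhs x) _) => j.
  have /cvgrPdist_le/(_ _ d0) := Ac i j.
  by apply: filterS => y; rewrite !mxE distrC.
near=> y.
have -> : f y - f x = (y - x) *m A y by near: y.
rewrite /L /= -mulmxBr.
apply: (le_trans (@mx_norm_mulmx_le _ _ _ _ _ d _ _)); first exact: ltW.
  by near: y.
rewrite ler_wpM2r// /d mulrA ler_pdivrMr// mulrC ler_wpM2l ?ltW//.
by rewrite ltrDl.
Unshelve. all: by end_near. Qed.

(** * The scalar equation for the density *)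

(** The mean value theorem; the left end may be 0, where P is merely
continuous.  Positivity of the pressure and monotonicity of the equation for
the density both come from this estimate. *)
Lemma eos_increment (R : realType) (P : R -> R) (a b : R) :
  equation_of_state P -> 0 <= a -> a < b -> 0 < P b - P a < b - a.
Proof.
move=> [_ Pc Pd] a0 ab.
have [||c cab ->] := @MVT R P (derive1 P) a b ab.
- move=> x /[!in_itv]/= /andP[ax _]; rewrite derive1E; apply: derivableP.
  by have [] := Pd x (le_lt_trans a0 ax).
- apply: continuous_subspaceW Pc => x /=; rewrite !in_itv/= andbT.
  by move=> /andP[ax _]; exact: le_trans ax.
move: cab; rewrite in_itv/= => /andP[ac _].
have [_ /andP[d0 d1] _] := Pd c (le_lt_trans a0 ac).
have ba : 0 < b - a by rewrite subr_gt0.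
by rewrite mulr_gt0//= gtr_pMl.
Qed.

Lemma eos_gt0 (R : realType) (P : R -> R) (rho : R) :
  equation_of_state P -> 0 < rho -> 0 < P rho.
Proof.
move=> eP rho0; have [P0 _ _] := eP.
by have /andP[+ _] := eos_increment eP (lexx 0) rho0; rewrite P0 subr0.
Qed.

Lemma eos_ge0 (R : realType) (P : R -> R) (rho : R) :
  equation_of_state P -> 0 <= rho -> 0 <= P rho.
Proof.
move=> eP; rewrite le_eqVlt => /orP[/eqP<-|/(eos_gt0 eP)/ltW//].
by have [-> _ _] := eP.
Qed.

(** The square of the momentum density of a state with energy density E and
rest density rho: it is ((rho + p) W^2 v)^2, with v^2 eliminated. *)
Definition momentum_sqr (R : realType) (P : R -> R) (E rho : R) : R :=
  (E - rho) * (E + P rho).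

(** From a to b the product changes by
- (b - a) (E + P a) + (E - b) (P b - P a).  For b <= E the second term is
dominated since E - b < E + P a and P b - P a < b - a; for b > E both terms are
negative. *)
Lemma momentum_sqr_decr (R : realType) (P : R -> R) (E a b : R) :
  equation_of_state P -> 0 < E -> 0 <= a -> a < b ->
  momentum_sqr P E b < momentum_sqr P E a.
Proof.
move=> eP E0 a0 ab; rewrite -subr_gt0 /momentum_sqr.
have /andP[P1 P2] := eos_increment eP a0 ab.
have Pa := eos_ge0 eP a0.
have ba : 0 < b - a by rewrite subr_gt0.
have [Eb|Eb] := leP 0 (E - b).
- have : (E - b) * (P b - P a) < (E + P a) * (b - a).
    by apply: ltr_pM => //; lra.
  by lra.
- have : 0 < (b - E) * (P b - P a) by apply: mulr_gt0; lra.
  have : 0 < (E + P a) * (b - a) by apply: mulr_gt0; lra.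
  by lra.
Qed.

(** The intermediate value theorem on [0, E]; the root is not 0 because the
value there is E ^ 2. *)
Lemma momentum_sqr_root (R : realType) (P : R -> R) (E m : R) :
  equation_of_state P -> 0 < E -> m ^+ 2 < E ^+ 2 ->
  exists2 rho, 0 < rho & momentum_sqr P E rho = m ^+ 2.
Proof.
move=> eP E0 mE; have [P0 Pc _] := eP.
have KE : momentum_sqr P E E = 0 by rewrite /momentum_sqr subrr mul0r.
have K0 : momentum_sqr P E 0 = E ^+ 2.
  by rewrite /momentum_sqr P0 subr0 addr0 expr2.
have [||rho] := @IVT R (momentum_sqr P E) 0 E (m ^+ 2) (ltW E0).
- have Pc' : {within `[0, E], continuous P}.
    by apply: continuous_subspaceW Pc; apply: subset_itvl.
  move=> x; apply: cvgM; apply: cvgD; try exact: cvg_cst; last exact: Pc'.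
  by apply: cvgN; apply: continuous_subspaceT => ? ?; exact: cvg_id.
- by rewrite KE K0 (min_idPr _) ?sqr_ge0// (max_idPl _) ?sqr_ge0// ltW.
rewrite in_itv/= => /andP[rho0 _] Km; exists rho => //.
rewrite lt_neqAle rho0 andbT; apply/eqP => r0.
by move: mE; rewrite -Km -r0 K0 ltxx.
Qed.

(** * Primitive states *)

Lemma forall_ord2 (Q : 'I_2 -> Prop) : Q 0 -> Q 1 -> forall i, Q i.
Proof.
move=> Q0 Q1; case=> [[|[|//]]] lti.
- by rewrite (_ : Ordinal lti = 0)//; exact: val_inj.
- by rewrite (_ : Ordinal lti = 1)//; exact: val_inj.
Qed.

Lemma sum_ord2 (R : realType) (F : 'I_2 -> R) : \sum_(i < 2) F i = F 0 + F 1.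
Proof. by rewrite big_ord_recl big_ord1; congr (_ + F _); exact: val_inj. Qed.

Lemma dot_vec2 (R : realType) (x : 'rV[R]_2) (a b : R) :
  dot x (vec2 a b) = x 0 0 * a + x 0 1 * b.
Proof. by rewrite /dot sum_ord2 !mxE. Qed.

Lemma vec2_eqP (R : realType) (a b : R) (x : 'rV[R]_2) :
  vec2 a b = x <-> a = x 0 0 /\ b = x 0 1.
Proof.
split=> [<-|[-> ->]]; first by rewrite !mxE.
by apply/rowP; apply: forall_ord2; rewrite !mxE.
Qed.

Lemma GpP (R : realType) (V : R * R * R) :
  Gp V <-> [/\ 0 < V.1.1, 0 < V.1.2 & `|V.2| < 1].
Proof. by case: V => [[]]. Qed.

Lemma GcP (R : realType) (U : 'rV[R]_2) :
  Gc U <-> 0 < U 0 0 + U 0 1 /\ 0 < U 0 0 - U 0 1.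
Proof. by rewrite /Gc /= !dot_vec2 mulrN1 !mulr1. Qed.

Lemma one_sub_sqr_gt0 (R : realType) (x : R) : `|x| < 1 -> 0 < 1 - x ^+ 2.
Proof. by move=> x1; rewrite subr_gt0 -real_normK ?num_real// expr_lt1. Qed.

Lemma lorentz_sqr (R : realType) (v : R) :
  `|v| < 1 -> lorentz v ^+ 2 = (1 - v ^+ 2)^-1.
Proof.
by move=> /one_sub_sqr_gt0 v1; rewrite /lorentz div1r exprVn sqr_sqrtr// ltW.
Qed.

(** Eliminating the velocity: W^2 (1 - v^2) = 1 turns the two conservative
equations into m = (E + p) v and E - rho = (E + p) v^2.  Conversely the root
automatically gives a subluminal velocity, as |m| < E < E + p. *)
Lemma primitive_statesP (R : realType) (P : R -> R) (U : 'rV[R]_2)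
    (V : R * R * R) : equation_of_state P -> Gc U ->
  primitive_states P U V <->
  [/\ 0 < V.1.1, momentum_sqr P (U 0 0) V.1.1 = U 0 1 ^+ 2,
      V.1.2 = P V.1.1 & V.2 = U 0 1 / (U 0 0 + P V.1.1)].
Proof.
move=> eP /GcP; case: V => [[rho p] v] /=.
set E : R := U 0 0; set m : R := U 0 1 => -[Em1 Em2]; rewrite /momentum_sqr.
split=> [[/= [rho0 p0 v1] pP /vec2_eqP[]]|[rho0 K pP vE]].
  rewrite /T00 /T01 -/E -/m lorentz_sqr// -pP; have := one_sub_sqr_gt0 v1.
  set q := 1 - _ => q0 TE Tm.
  have w0 : 0 < E + p.
    by rewrite -TE subrK; apply: divr_gt0 => //; exact: addr_gt0.
  have mE : m = (E + p) * v by rewrite -Tm -TE subrK.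
  split => //; last by rewrite mE mulrAC divff ?mul1r ?gt_eqF.
  have rhoE : rho = (E + p) * q - p.
    by rewrite -TE subrK divfK ?addrK// gt_eqF.
  by rewrite mE rhoE /q; ring.
have p0 : 0 < p by rewrite pP eos_gt0.
have w0 : 0 < E + p by lra.
rewrite -pP in K vE.
have mE : m = (E + p) * v by rewrite vE mulrC divfK// gt_eqF.
have rhoE : rho = E - (E + p) * v ^+ 2.
  by apply: (mulIf (lt0r_neq0 w0)); rewrite mE in K; lra.
have v1 : `|v| < 1.
  rewrite vE normf_div (gtr0_norm w0) ltr_pdivrMr// mul1r.
  by rewrite ltr_norml; apply/andP; split; lra.
have q0 := one_sub_sqr_gt0 v1.
have Lq : (rho + p) / (1 - v ^+ 2) = E + p.
  by apply: (canLR (mulfK (lt0r_neq0 q0))); rewrite rhoE; ring.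
split => //=; apply/vec2_eqP.
by rewrite /T00 /T01 lorentz_sqr// Lq addrK -mE.
Qed.

Lemma primitive_unique (R : realType) (P : R -> R) (U : 'rV[R]_2) :
  equation_of_state P -> Gc U ->
  unique (primitive_states P U) (primitive P U).
Proof.
move=> eP GU; have /GcP[Em1 Em2] := GU.
have E0 : 0 < U 0 0 by lra.
have [|rho rho0 K] := @momentum_sqr_root R P (U 0 0) (U 0 1) eP E0.
  by rewrite -subr_gt0 subr_sqr mulr_gt0.
have rootU V : primitive_states P U V -> primitive_states P U (primitive P U).
  by move=> PV; apply: xgetPex; exists V.
have PU : primitive_states P U (primitive P U).
  by apply: (rootU (rho, P rho, U 0 1 / (U 0 0 + P rho)));
  apply/primitive_statesP.
split => // V; move: PU.
move=> /(primitive_statesP _ eP GU) + /(primitive_statesP _ eP GU).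
case: (primitive P U) => [[r1 p1] v1]; case: V => [[r2 p2] v2] /=.
move=> [r10 K1 -> ->] [r20 K2 -> ->].
suff -> : r1 = r2 by [].
have [r12|r21|//] := ltgtP r1 r2.
- by have := momentum_sqr_decr eP E0 (ltW r10) r12; rewrite K1 K2 ltxx.
- by have := momentum_sqr_decr eP E0 (ltW r20) r21; rewrite K1 K2 ltxx.
Qed.

Lemma T11E (R : realType) (rho p v : R) : `|v| < 1 ->
  T11 (rho, p, v) = T00 (rho, p, v) - rho + p.
Proof.
move=> v1; have q0 := lt0r_neq0 (one_sub_sqr_gt0 v1).
by rewrite /T11 /T00 lorentz_sqr//; field.
Qed.

(** On the admissible set the flux needs neither v nor W, because
T00 - T11 = rho - p. *)
Lemma fluxE (R : realType) (P : R -> R) (U : 'rV[R]_2) :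
  equation_of_state P -> Gc U ->
  let rho := (primitive P U).1.1 in
  flux P U = vec2 (U 0 1) (U 0 0 - rho + P rho).
Proof.
move=> eP GU; have [+ _] := primitive_unique eP GU.
rewrite /flux; case: (primitive P U) => [[rho p] v].
move=> [[_ _ v1] pP /vec2_eqP[EE mE]].
by rewrite T11E// EE mE -pP.
Qed.

(** * Flux and characteristic speeds *)

Lemma characteristic_denominators_gt0 (R : realType) (c v : R) :
  0 < c < 1 -> `|v| < 1 -> 0 < 1 - c * v /\ 0 < 1 + c * v.
Proof.
move=> /andP[c0 c1] v1.
have : `|c * v| < 1.
  by rewrite normrM gtr0_norm// -[ltRHS]mulr1 ltr_pM// ltW.
by rewrite ltr_norml => /andP[cvN cvP]; split; lra.
Qed.

(** After clearing denominators the four gaps are (1 + v) or (1 - v) times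
c rho + p or c rho - p. *)
Lemma flux_between_characteristics (R : realType) (V : R * R * R) (c : R)
    (n : 'rV[R]_2) :
  Gp V -> 0 < c < 1 -> V.1.2 < c * V.1.1 ->
  n = vec2 1 1 \/ n = vec2 1 (-1) ->
  (V.2 - c) / (1 - c * V.2) * dot (conservative V) n <
    dot (vec2 (T01 V) (T11 V)) n /\
  dot (vec2 (T01 V) (T11 V)) n <
    (V.2 + c) / (1 + c * V.2) * dot (conservative V) n.
Proof.
case: V => [[rho p] v] [rho0 p0 v1] c01 pc nE; have /andP[c0 c1] := c01.
rewrite -[(rho, p, v).2]/v; rewrite -[_.1.2]/p -[_.1.1]/rho in pc.
have q0 := one_sub_sqr_gt0 v1; have q0' := lt0r_neq0 q0.
have [vN vP] : - 1 < v /\ v < 1 by apply/andP; rewrite -ltr_norml.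
have [d1 d2] := characteristic_denominators_gt0 c01 v1.
have pos1 : 0 < (1 + v) * (c * rho + p).
  by apply: mulr_gt0; [lra|rewrite addr_gt0// mulr_gt0].
have pos2 : 0 < (1 + v) * (c * rho - p) by apply: mulr_gt0; lra.
have pos3 : 0 < (1 - v) * (c * rho + p).
  by apply: mulr_gt0; [lra|rewrite addr_gt0// mulr_gt0].
have pos4 : 0 < (1 - v) * (c * rho - p) by apply: mulr_gt0; lra.
rewrite mulrAC ltr_pdivrMr// [X in _ /\ _ < X]mulrAC ltr_pdivlMr//.
rewrite T11E// /conservative; set V := (rho, p, v).
pose w := (rho + p) / (1 - v ^+ 2).
have -> : T00 V = w - p by rewrite /T00 /V /= lorentz_sqr.
have -> : T01 V = w * v by rewrite /T01 /V /= lorentz_sqr.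
have rhoE : rho = w * (1 - v ^+ 2) - p by rewrite /w divfK ?addrK.
case: nE => ->; rewrite !dot_vec2 !mxE/=.
- split; rewrite -subr_gt0.
  + rewrite [ltRHS](_ : _ = (1 + v) * (c * rho + p))//.
    by rewrite rhoE; ring.
  + rewrite [ltRHS](_ : _ = (1 + v) * (c * rho - p))//.
    by rewrite rhoE; ring.
- split; rewrite -subr_gt0.
  + rewrite [ltRHS](_ : _ = (1 - v) * (c * rho - p))//.
    by rewrite rhoE; ring.
  + rewrite [ltRHS](_ : _ = (1 - v) * (c * rho + p))//.
    by rewrite rhoE; ring.
Qed.

(** * Companion matrices of quadratics *)

(** The Jacobian shape of a flux (m, g (E, m)), with a and b the partial
derivatives of g; its characteristic polynomial is X^2 - b X - a. *)
Definition companion2 (R : realType) (a b : R) : 'M[R]_2 :=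
  \matrix_(i, j) (if j == 0 then (i == 1)%:R else if i == 0 then a else b).

Lemma mulmx_companion2 (R : realType) (v : 'rV[R]_2) (a b : R) :
  v *m companion2 a b = vec2 (v 0 1) (v 0 0 * a + v 0 1 * b).
Proof.
apply/esym/vec2_eqP; rewrite !mxE !sum_ord2 !mxE/=.
by rewrite mulr0 add0r mulr1.
Qed.

(** A row eigenvector for a is proportional to (1, a). *)
Lemma eigenvalue_companion2 (R : realType) (s t a : R) :
  eigenvalue (companion2 (- (s * t)) (s + t)) a <-> a = s \/ a = t.
Proof.
split=> [/eigenvalueP[v]|ast].
  rewrite mulmx_companion2 => /vec2_eqP[]; rewrite !mxE => e1 e2 v0.
  have v00 : v 0 0 != 0.
    apply: contraNneq v0 => v00; apply/eqP/rowP.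
    by apply: forall_ord2; rewrite mxE// e1 v00 mulr0.
  have /eqP : (a - s) * (a - t) = 0.
    by apply: (mulIf v00); rewrite mul0r; rewrite e1 in e2; lra.
  by rewrite mulf_eq0 !subr_eq0 => /orP[] /eqP; [left|right].
apply/eigenvalueP; exists (vec2 1 a).
  rewrite mulmx_companion2; apply/vec2_eqP; rewrite !mxE/= !mulr1 mul1r.
  by split => //; case: ast => ->; ring.
by apply/eqP => /vec2_eqP[] /eqP; rewrite mxE oner_eq0.
Qed.

(** * Differentiating the flux *)

Lemma cvg_coord (R : realType) n (x : 'rV[R]_n) j :
  (fun y : 'rV[R]_n => y 0 j) @ x --> x 0 j.
Proof. exact: coord_continuous. Qed.

Lemma near_Gc (R : realType) (U : 'rV[R]_2) : Gc U -> \forall y \near U, Gc y.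
Proof.
move=> /GcP[U1 U2]; near=> y; apply/GcP; split; near: y.
- by apply: cvgr_gt U1; apply: cvgD; exact: cvg_coord.
- by apply: cvgr_gt U2; apply: cvgB; exact: cvg_coord.
Unshelve. all: by end_near. Qed.

(** For a < rho(U) < b, the strict inequalities
momentum_sqr a > m^2 > momentum_sqr b at U persist at nearby points y, and there
monotonicity forces a < rho(y) < b. *)
Lemma cvg_density (R : realType) (P : R -> R) (U : 'rV[R]_2) :
  equation_of_state P -> Gc U ->
  (primitive P y).1.1 @[y --> U] --> (primitive P U).1.1.
Proof.
move=> eP GU.
have prim y : Gc y -> [/\ 0 < y 0 0, 0 < (primitive P y).1.1 &
    momentum_sqr P (y 0 0) (primitive P y).1.1 = y 0 1 ^+ 2].
  move=> Gy; have [Py _] := primitive_unique eP Gy.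
  have [] := (primitive_statesP _ eP Gy).1 Py.
  by have /GcP[] := Gy; split=> //; lra.
have [E0 r0 Kr] := prim _ GU.
set r := (primitive P U).1.1 in r0 Kr *.
have cK z : (fun y : 'rV[R]_2 => momentum_sqr P (y 0 0) z - y 0 1 ^+ 2) @ U -->
    momentum_sqr P (U 0 0) z - U 0 1 ^+ 2.
  apply: cvgB (cvgM (@cvg_coord _ _ U 1) (@cvg_coord _ _ U 1)).
  have E := @cvg_coord _ _ U 0.
  exact: cvgM (cvgB E (cvg_cst _)) (cvgD E (cvg_cst _)).
apply/(@cvgrPdist_lt _ _ _ (nbhs U) (nbhs_filter U)) => e e0.
(* The minimum keeps a nonnegative, where monotonicity is available. *)
pose a := r - Num.min e r; pose b := r + e.
have [ae a0] : r - e <= a /\ 0 <= a.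
  by rewrite /a lerD2l lerN2 ge_min lexx subr_ge0 ge_min lexx orbT.
have ar : a < r by rewrite /a gtrDl oppr_lt0 lt_min e0 r0.
have rb : r < b by rewrite ltrDl.
have b0 : 0 <= b by rewrite ltW// (lt_trans r0).
near=> y.
have Gy : Gc y by near: y; exact: near_Gc.
have [y0 ry0 Ky] := prim _ Gy.
have Ka : 0 < momentum_sqr P (y 0 0) a - y 0 1 ^+ 2.
  near: y; apply: (cvgr_gt _ (cK a)).
  by rewrite subr_gt0 -Kr momentum_sqr_decr.
have Kb : momentum_sqr P (y 0 0) b - y 0 1 ^+ 2 < 0.
  near: y; apply: (cvgr_lt _ (cK b)).
  by rewrite subr_lt0 -Kr momentum_sqr_decr// ltW.
rewrite -Ky subr_gt0 in Ka; rewrite -Ky subr_lt0 in Kb.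
rewrite distrC ltr_distl; apply/andP; split.
  rewrite (le_lt_trans ae)// ltNge; apply/negP.
  rewrite le_eqVlt => /predU1P[ra|ra]; first by rewrite ra ltxx in Ka.
  have := momentum_sqr_decr eP y0 (ltW ry0) ra.
  by move=> /(lt_trans Ka); rewrite ltxx.
rewrite -/b ltNge; apply/negP.
rewrite le_eqVlt => /predU1P[br|br]; first by rewrite br ltxx in Kb.
by have := lt_trans (momentum_sqr_decr eP y0 b0 br) Kb; rewrite ltxx.
Unshelve. all: by end_near. Qed.

(** With dE, dm, dr the increments from U to y, m and w the values at y of the
momentum density and of E + p, and phi the difference quotient of P, the
difference of the two defining equations reads
(dE - dr) w + (E0 - rho0) (dE + phi dr) = (m + m0) dm.
It is linear in dr, and the coefficient D of dr stays away from 0 because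
(E0 - rho0) P' < E0 < E0 + p0. *)
Lemma flux_jacobian (R : realType) (P : R -> R) (U : 'rV[R]_2) :
  equation_of_state P -> Gc U ->
  differentiable (flux P) U /\
  jacobian (flux P) U = companion2 (- (s1 P U * s2 P U)) (s1 P U + s2 P U).
Proof.
move=> eP GU.
have [PU _] := primitive_unique eP GU.
have [/GpP[rho0 p0 v1] pP _] := PU.
have [_ Kr _ vE] := (primitive_statesP _ eP GU).1 PU.
set r := fun y => (primitive P y).1.1.
rewrite -/(r U) in rho0 pP Kr vE.
have /GcP[Em1 Em2] := GU.
have [_ _ /(_ _ rho0)[dP /andP[dP0 dP1] _]] := eP.
have /is_derive1_caratheodory[phi [phiE phic phir]] :
  is_derive (r U) 1 P (derive1 P (r U)).
  by rewrite derive1E; exact: derivableP.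
pose w (y : 'rV[R]_2) := y 0 0 + P (r y).
pose D y := w y - (U 0 0 - r U) * phi (r y).
(* al and - be are the coefficients of dE and dm in dr. *)
pose al (y : 'rV[R]_2) := (w y + (U 0 0 - r U)) / D y.
pose be (y : 'rV[R]_2) := (y 0 1 + U 0 1) / D y.
pose A y := companion2 (1 - (1 - phi (r y)) * al y) ((1 - phi (r y)) * be y).
have Pr0 y : Gc y -> 0 < P (r y).
  move=> Gy; have [Py _] := primitive_unique eP Gy.
  by have [] := (primitive_statesP _ eP Gy).1 Py; move=> /(eos_gt0 eP).
have w0 : 0 < w U by rewrite /w; have := Pr0 _ GU; lra.
have Er : 0 <= U 0 0 - r U.
  by rewrite -(pmulr_lge0 _ w0) -/(momentum_sqr P (U 0 0) (r U)) Kr sqr_ge0.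
have D0 : 0 < D U.
  rewrite /D phir subr_gt0; apply: (@le_lt_trans _ _ (U 0 0 - r U)).
    by rewrite ler_piMr// ltW.
  by rewrite /w; have := Pr0 _ GU; lra.
have cr := cvg_density eP GU.
have cphi : phi (r y) @[y --> U] --> phi (r U) by exact: cvg_comp cr phic.
have cP : P (r y) @[y --> U] --> P (r U).
  have Pc : {for r U, continuous P}.
    by apply: differentiable_continuous; exact/derivable1_diffP.
  exact: cvg_comp cr Pc.
have cw : w y @[y --> U] --> w U.
  exact: cvgD (@cvg_coord _ _ U 0) cP.
have cD : D y @[y --> U] --> D U.
  exact: cvgB cw (cvgM (cvg_cst _) cphi).
have c1phi : 1 - phi (r y) @[y --> U] --> 1 - phi (r U).
  exact: cvgB (cvg_cst _) cphi.
have cal : al y @[y --> U] --> al U.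
  exact: cvgM (cvgD cw (cvg_cst _)) (cvgV (lt0r_neq0 D0) cD).
have cbe : be y @[y --> U] --> be U.
  apply: cvgM (cvgV (lt0r_neq0 D0) cD).
  exact: cvgD (@cvg_coord _ _ U 1) (cvg_cst _).
have [||dF ->] := @jacobian_caratheodory R 2 2 (flux P) U A.
- move=> i j; rewrite /prop_for /continuous_at mxE.
  rewrite (_ : (fun y => A y i j) = fun y => if j == 0 then (i == 1)%:R else
    if i == 0 then 1 - (1 - phi (r y)) * al y else (1 - phi (r y)) * be y).
    case: (j == 0); first exact: (@cvg_cst _ _ _ _ (nbhs_filter U)).
    case: (i == 0); last exact: cvgM c1phi cbe.
    exact: cvgB (cvg_cst _) (cvgM c1phi cal).
  by apply/funext => y; rewrite mxE.
- near=> y.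
  have Gy : Gc y by near: y; exact: near_Gc.
  have Dy : D y != 0.
    near: y; move: D0 => /(cvgr_gt _ cD); apply: filterS => y.
    by move=> /lt0r_neq0.
  have Ky : momentum_sqr P (y 0 0) (r y) = y 0 1 ^+ 2.
    have [Py _] := primitive_unique eP Gy.
    by have [] := (primitive_statesP _ eP Gy).1 Py.
  have dr : r y - r U = (y 0 0 - U 0 0) * al y - (y 0 1 - U 0 1) * be y.
    apply: (mulIf Dy).
    rewrite [RHS](_ : _ = (y 0 0 - U 0 0) * (w y + (U 0 0 - r U)) -
      (y 0 1 - U 0 1) * (y 0 1 + U 0 1)); last by rewrite /al /be; field.
    have := congr1 ( *%R (U 0 0 - r U)) (phiE (r y)).
    by move: Ky Kr; rewrite /D /w /momentum_sqr; lra.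
  have dPr := phiE (r y).
  rewrite !fluxE// mulmx_companion2; apply/esym/vec2_eqP.
  rewrite !mxE/= -/(r y) -/(r U).
  split => //.
  have -> : P (r y) = P (r U) + phi (r y) * (r y - r U) by lra.
  rewrite (_ : r y = r U + (r y - r U)); last by rewrite addrC subrK.
  by rewrite dr; ring.
split => //.
rewrite /A /al /be /D phir /s1 /s2 /velocity /sound_speed -/(r U).
set c := Num.sqrt _; set v := (primitive P U).2 in v1 vE *.
have c2 : derive1 P (r U) = c ^+ 2 by rewrite sqr_sqrtr// ltW.
have c01 : 0 < c < 1 by rewrite sqrtr_gt0 dP0 -sqrtr1 ltr_sqrt.
have mE : U 0 1 = w U * v by rewrite vE mulrC divfK// gt_eqF.
have ErE : U 0 0 - r U = w U * v ^+ 2.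
  apply: (mulIf (lt0r_neq0 w0)).
  by rewrite -/(momentum_sqr P (U 0 0) (r U)) Kr mE; ring.
have [cv1 cv2] := characteristic_denominators_gt0 c01 v1.
(* In terms of w, v and c, at U the claim is an identity of rational functions;
   this is the value of D. *)
have D0' : w U - w U * v ^+ 2 * c ^+ 2 != 0.
  rewrite (_ : _ - _ = w U * ((1 - c * v) * (1 + c * v))); last by ring.
  by rewrite !mulf_neq0 ?lt0r_neq0.
rewrite c2 mE ErE; clearbody v.
by congr companion2; field; rewrite D0' !lt0r_neq0.
Unshelve. all: by end_near. Qed.

(* [jacobian] acts on row vectors, so it is the transpose of the column-vector
   Jacobian, and [eigenvalue] refers to row eigenvectors: together they give
   the usual eigenvalues of the Jacobian matrix.
   The signs s1 < 0 and s2 > 0 hold exactly when v < sqrt P'(rho),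
   respectively v > - sqrt P'(rho); they fail for supersonic states. *)
Theorem lemma3p4 (R : realType) (P : R -> R) (U : 'rV[R]_2) :
  equation_of_state P ->
  Gc U ->
  unique (primitive_states P U) (primitive P U) /\
  (forall n : 'rV[R]_2, n = vec2 1 1 \/ n = vec2 1 (-1) ->
     dot (flux P U) n > s1 P U * dot U n /\
     dot (flux P U) n < s2 P U * dot U n) /\
  (s1 P U < 0 <-> velocity P U < sound_speed P U) /\
  (s2 P U > 0 <-> - sound_speed P U < velocity P U) /\
  differentiable (flux P) U /\
  (forall a : R, eigenvalue (jacobian (flux P) U) a <-> a = s1 P U \/ a = s2 P U).
Proof.
move=> eP GU; have PU := primitive_unique eP GU; split=> //.
have [[VG pP UE] _] := PU; have /GpP[rho0 _ v1] := VG.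
have [_ _ /(_ _ rho0)[_ /andP[dP0 dP1] Pc]] := eP.
have c01 : 0 < sound_speed P U < 1 by rewrite sqrtr_gt0 dP0 -sqrtr1 ltr_sqrt.
have [d1 d2] := characteristic_denominators_gt0 c01 v1.
have [dF JE] := flux_jacobian eP GU.
split; last split; last split; last split.
- move=> n nE; have := @flux_between_characteristics _ _ _ n VG c01 _ nE.
  by rewrite UE; apply; rewrite pP.
- by rewrite /s1 pmulr_llt0 ?invr_gt0// subr_lt0.
- by rewrite /s2 pmulr_lgt0 ?invr_gt0// -ltrBlDr sub0r.
- exact: dF.
- by move=> a; rewrite JE; exact: eigenvalue_companion2.
Qed.
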